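(* Let $G_1$ and $G_2$ be isoclinic groups (possibly infinite). Then $\tilde{\mathrm{B}}_0(G_1)\cong \tilde{\mathrm{B}}_0(G_2)$. In particular, if $G_1$ and $G_2$ are finite, then the Bogomolov multipliers $\mathrm{B}_0(G_1)$ and $\mathrm{B}_0(G_2)$ are isomorphic.
   Context: For elements $x,y$ of a group write ${}^xy=xyx^{-1}$ and $[x,y]=xyx^{-1}y^{-1}$. For a group $G$, $Z(G)$ denotes its center and $[G,G]$ its derived (commutator) subgroup. Isoclinism (P. Hall): groups $G_1$ and $G_2$, with centers $Z_1=Z(G_1)$ and $Z_2=Z(G_2)$, are isoclinic if there exist group isomorphisms $\alpha: G_1/Z_1\to G_2/Z_2$ and $\beta:[G_1,G_1]\to[G_2,G_2]$ such that, for all $a_1,b_1\in G_1$ and $a_2,b_2\in G_2$, if $\alpha(a_1Z_1)=a_2Z_2$ and $\alpha(b_1Z_1)=b_2Z_2$, then $\beta([a_1,b_1])=[a_2,b_2]$. The group $G\curlywedge G$: for any (possibly infinite) group $G$, $G\curlywedge G$ is the group generated by the symbols $m\curlywedge n$, $m,n\in G$, subject to the relations $$mm'\curlywedge n=({}^mm'\curlywedge {}^mn)(m\curlywedge n),\qquad m\curlywedge nn'=(m\curlywedge n)({}^nm\curlywedge {}^nn'),\qquad x\curlywedge y=1,$$ for all $m,m',n,n'\in G$ and all $x,y\in G$ with $[x,y]=1$. There is a surjective group homomorphism $\kappa:G\curlywedge G\to[G,G]$ determined by $\kappa(x\curlywedge y)=[x,y]$ for all $x,y\in G$. Define $\tilde{\mathrm{B}}_0(G)=\ker\kappa$.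 Bogomolov multiplier: for a finite group $G$, $$\mathrm{B}_0(G)=\bigcap_{A\le G,\ A\text{ abelian}}\ker\left(\mathrm{res}^G_A:\mathrm{H}^2(G,\mathbb{Q}/\mathbb{Z})\to \mathrm{H}^2(A,\mathbb{Q}/\mathbb{Z})\right),$$ where the intersection is over all abelian subgroups $A$ of $G$, $\mathbb{Q}/\mathbb{Z}$ has trivial action, and $\mathrm{res}^G_A$ is the usual cohomological restriction map. Known fact (from earlier work) linking the two invariants: for a finite group $G$, $\mathrm{B}_0(G)$ is naturally isomorphic to $\mathrm{Hom}(\tilde{\mathrm{B}}_0(G),\mathbb{Q}/\mathbb{Z})$, and thus $\mathrm{B}_0(G)\cong\tilde{\mathrm{B}}_0(G)$. *)

(* Defs.v *)
From HB Require Import structures.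
From mathcomp Require Import all_boot all_order all_algebra archimedean.
From mathcomp Require Import ring_quotient.
From mathcomp Require Import boolp classical_sets functions cardinality.

Set Implicit Arguments.
Unset Strict Implicit.
Unset Printing Implicit Defensive.

Import GRing.Theory.

Local Open Scope group_scope.
Local Open Scope quotient_scope.

(* Left-handed conventions; the library has [x ^ y = y^-1 * x * y] and
   [[~ x, y] = x^-1 * y^-1 * x * y] instead. *)

Definition lconj (G : groupType) (x y : G) : G := x * y * x^-1.

Definition lcomm (G : groupType) (x y : G) : G := x * y * x^-1 * y^-1.

Lemma lcommMl (G : groupType) (m m' n : G) :
  lcomm (m * m') n = lcomm (lconj m m') (lconj m n) * lcomm m n.
Proof. by rewrite /lcomm /lconj !invgM !invgK !mulgA !mulgVK. Qed.

Lemma lcommMr (G : groupType) (m n n' : G) :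
  lcomm m (n * n') = lcomm m n * lcomm (lconj n m) (lconj n n').
Proof. by rewrite /lcomm /lconj !invgM !invgK !mulgA !mulgVK. Qed.

Definition isomorphic (G H : groupType) : Prop :=
  exists f : {multiplicative G -> H}, bijective f.

Definition isomorphic_zmod (U V : zmodType) : Prop :=
  exists f : {additive U -> V}, bijective f.

Section Subgroup.
Variables (G : groupType) (S : groupClosed G).

Record subgroup : Type := Subgroup { sgval : G; sgvalP : sgval \in S }.

HB.instance Definition _ := [isSub for sgval].
HB.instance Definition _ := [Choice of subgroup by <:].

Fact subgroup_closed : group_closed (fun x : G => x \in S).
Proof. by split; [exact: gpred1 | exact: gpredF]. Qed.

HB.instance Definition _ :=
  SubChoice_isSubGroup.Build G _ subgroup subgroup_closed.

End Subgroup.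

Section Center.
Variable G : groupType.

Definition center : {pred G} := [pred z | `[< forall x, z * x = x * z >]].

Lemma centerP (z : G) : reflect (forall x, z * x = x * z) (z \in center).
Proof. exact: asboolP. Qed.

Fact center_mul : mulg_closed center.
Proof.
move=> x y /centerP xZ /centerP yZ; apply/centerP => z.
by rewrite -mulgA yZ !mulgA xZ.
Qed.

Fact center_one : 1 \in center.
Proof. by apply/centerP => z; rewrite mul1g mulg1. Qed.

Fact center_inv : invg_closed center.
Proof.
move=> x /centerP xZ; apply/centerP => z.
by apply: (mulgI x); rewrite mulVKg mulgA xZ mulgK.
Qed.

HB.instance Definition _ := isMulClosed.Build G center center_mul.
HB.instance Definition _ := isMul1Closed.Build G center center_one.
HB.instance Definition _ := isInvClosed.Build G center center_inv.

Definition center_rel (x y : G) : bool := x^-1 * y \in center.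

Fact center_rel_refl : reflexive center_rel.
Proof. by move=> x; rewrite /center_rel mulVg gpred1. Qed.

Fact center_rel_sym : symmetric center_rel.
Proof. by move=> x y; rewrite /center_rel -gpredV invgM invgK. Qed.

Fact center_rel_trans : transitive center_rel.
Proof.
move=> y x z xy yz; rewrite /center_rel.
by rewrite -[z](mulVKg y) mulgA gpredM.
Qed.

Canonical center_rel_equiv :=
  EquivRel center_rel center_rel_refl center_rel_sym center_rel_trans.

Definition central_quotient : Type := {eq_quot center_rel}.

HB.instance Definition _ := Choice.on central_quotient.
HB.instance Definition _ : EqQuotient G center_rel central_quotient :=
  EqQuotient.on central_quotient.

Lemma cq_eqE (x y : G) :
  (x == y %[mod central_quotient]) = (x^-1 * y \in center).
Proof. by rewrite piE. Qed.

Definition cq_one : central_quotient := \pi_central_quotient 1.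
Definition cq_inv (a : central_quotient) : central_quotient :=
  \pi_central_quotient (repr a)^-1.
Definition cq_mul (a b : central_quotient) : central_quotient :=
  \pi_central_quotient (repr a * repr b).

Fact cq_mulE (x y : G) : cq_mul (\pi x) (\pi y) = \pi_central_quotient (x * y).
Proof.
rewrite /cq_mul; case: (piP central_quotient x) => x' /eqP.
rewrite cq_eqE => /centerP xZ; case: (piP central_quotient y) => y' /eqP.
rewrite cq_eqE => yZ; apply/eqP; rewrite eq_sym cq_eqE invgM -mulgA.
by rewrite (mulgA x^-1) xZ (mulgA y^-1) gpredM //; apply/centerP.
Qed.

Fact cq_invE (x : G) : cq_inv (\pi x) = \pi_central_quotient x^-1.
Proof.
rewrite /cq_inv; case: (piP central_quotient x) => x' /eqP.
rewrite cq_eqE => /centerP xZ; apply/eqP; rewrite cq_eqE invgK.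
suff -> : x' * x^-1 = x^-1 * x' by apply/centerP.
by rewrite -{1}[x'](mulVKg x) -mulgA xZ mulVKg.
Qed.

Fact cq_mulA : associative cq_mul.
Proof.
by move=> a b c; rewrite -[a]reprK -[b]reprK -[c]reprK !cq_mulE mulgA.
Qed.

Fact cq_mul1 : left_id cq_one cq_mul.
Proof. by move=> a; rewrite -[a]reprK cq_mulE mul1g. Qed.

Fact cq_mul1r : right_id cq_one cq_mul.
Proof. by move=> a; rewrite -[a]reprK cq_mulE mulg1. Qed.

Fact cq_mulV : left_inverse cq_one cq_inv cq_mul.
Proof. by move=> a; rewrite -[a]reprK cq_invE cq_mulE mulVg. Qed.

Fact cq_mulVr : right_inverse cq_one cq_inv cq_mul.
Proof. by move=> a; rewrite -[a]reprK cq_invE cq_mulE mulgV. Qed.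

HB.instance Definition _ :=
  isGroup.Build central_quotient cq_mulA cq_mul1 cq_mul1r cq_mulV cq_mulVr.

End Center.

Section Derived.
Variable G : groupType.

Inductive in_derived : G -> Prop :=
| in_derived1 : in_derived 1
| in_derived_comm x y : in_derived (lcomm x y)
| in_derivedM x y : in_derived x -> in_derived y -> in_derived (x * y)
| in_derivedV x : in_derived x -> in_derived x^-1.

Definition derived : {pred G} := [pred x | `[< in_derived x >]].

Lemma derivedP (x : G) : reflect (in_derived x) (x \in derived).
Proof. exact: asboolP. Qed.

Fact derived_mul : mulg_closed derived.
Proof.
by move=> x y /derivedP xD /derivedP yD; apply/derivedP/in_derivedM.
Qed.

Fact derived_one : 1 \in derived.
Proof. exact/derivedP/in_derived1. Qed.

Fact derived_inv : invg_closed derived.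
Proof. by move=> x /derivedP xD; apply/derivedP/in_derivedV. Qed.

HB.instance Definition _ := isMulClosed.Build G derived derived_mul.
HB.instance Definition _ := isMul1Closed.Build G derived derived_one.
HB.instance Definition _ := isInvClosed.Build G derived derived_inv.

Definition derived_group : Type := subgroup derived.
HB.instance Definition _ := Group.on derived_group.

Fact lcomm_derived (x y : G) : lcomm x y \in derived.
Proof. exact/derivedP/in_derived_comm. Qed.

Definition dcomm (x y : G) : derived_group := Subgroup (lcomm_derived x y).

End Derived.

Definition isoclinic (G1 G2 : groupType) : Prop :=
  exists (alpha : {multiplicative central_quotient G1 -> central_quotient G2})
         (beta : {multiplicative derived_group G1 -> derived_group G2}),
  [/\ bijective alpha, bijective beta &
      forall (a1 b1 : G1) (a2 b2 : G2),
        alpha (\pi a1) = \pi a2 -> alpha (\pi b1) = \pi b2 ->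
        beta (dcomm a1 b1) = dcomm a2 b2].

Section Presentation.
Variable X : choiceType.

(* The letter [(x, false)] stands for the generator [x] and [(x, true)] for
   its formal inverse. *)
Definition word : Type := seq (X * bool).
HB.instance Definition _ := Choice.on word.

Definition word_inv (w : word) : word := rev [seq (l.1, ~~ l.2) | l <- w].

Definition word_eval (H : groupType) (f : X -> H) (w : word) : H :=
  \prod_(l <- w) (if l.2 then (f l.1)^-1 else f l.1).

Variable R : word -> word -> Prop.

Inductive word_eq : word -> word -> Prop :=
| word_eq_refl u : word_eq u u
| word_eq_sym u v : word_eq u v -> word_eq v u
| word_eq_trans u v w : word_eq u v -> word_eq v w -> word_eq u w
| word_eq_cat u u' v v' :
    word_eq u u' -> word_eq v v' -> word_eq (u ++ v) (u' ++ v')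
| word_eq_cancel x b : word_eq [:: (x, b); (x, ~~ b)] [::]
| word_eq_rel u v : R u v -> word_eq u v.

Definition word_eqb (u v : word) : bool := `[< word_eq u v >].

Fact word_eqb_refl : reflexive word_eqb.
Proof. by move=> u; apply/asboolP/word_eq_refl. Qed.

Fact word_eqb_sym : symmetric word_eqb.
Proof. by move=> u v; apply/asboolP/asboolP => /word_eq_sym. Qed.

Fact word_eqb_trans : transitive word_eqb.
Proof.
by move=> v u w /asboolP uv /asboolP vw; apply/asboolP/(word_eq_trans uv).
Qed.

Canonical word_eqb_equiv :=
  EquivRel word_eqb word_eqb_refl word_eqb_sym word_eqb_trans.

Definition presented : Type := {eq_quot word_eqb}.

HB.instance Definition _ := Choice.on presented.
HB.instance Definition _ : EqQuotient word word_eqb presented :=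
  EqQuotient.on presented.

Lemma presented_eqP (u v : word) :
  reflect (word_eq u v) (u == v %[mod presented]).
Proof. by rewrite piE; exact: asboolP. Qed.

Definition presented_gen (x : X) : presented :=
  \pi_presented [:: (x, false)].
Definition presented_one : presented := \pi_presented [::].
Definition presented_inv (a : presented) : presented :=
  \pi_presented (word_inv (repr a)).
Definition presented_mul (a b : presented) : presented :=
  \pi_presented (repr a ++ repr b).

Lemma word_eq_mulV u : word_eq (u ++ word_inv u) [::].
Proof.
elim/last_ind: u => [|u [x b] IHu]; first exact: word_eq_refl.
rewrite /word_inv map_rcons rev_rcons -cats1 -catA /=.
rewrite -[_ :: _ :: _]/([:: (x, b); (x, ~~ b)] ++ word_inv u).
apply: word_eq_trans IHu; apply: word_eq_cat; first exact: word_eq_refl.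
by rewrite -[X in word_eq _ X]cat0s; apply: word_eq_cat;
  [exact: word_eq_cancel | exact: word_eq_refl].
Qed.

Lemma word_invK : involutive word_inv.
Proof.
move=> u; rewrite /word_inv map_rev revK -map_comp -[RHS]map_id.
by apply: eq_map => -[x b] /=; rewrite negbK.
Qed.

Lemma word_eq_Vmul u : word_eq (word_inv u ++ u) [::].
Proof. by rewrite -{2}[u]word_invK; exact: word_eq_mulV. Qed.

Lemma word_eq_inv u v : word_eq u v -> word_eq (word_inv u) (word_inv v).
Proof.
move=> uv; apply: (@word_eq_trans _ (word_inv u ++ (v ++ word_inv v))).
  rewrite -{1}[word_inv u]cats0; apply: word_eq_cat.
    exact: word_eq_refl.
  exact/word_eq_sym/word_eq_mulV.
rewrite catA -{2}[word_inv v]cat0s; apply: word_eq_cat; last first.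
  exact: word_eq_refl.
apply: word_eq_trans (word_eq_Vmul u); apply: word_eq_cat.
  exact: word_eq_refl.
exact: word_eq_sym.
Qed.

Fact presented_mulE (u v : word) :
  presented_mul (\pi u) (\pi v) = \pi_presented (u ++ v).
Proof.
rewrite /presented_mul; case: (piP presented u) => u' /eqP/presented_eqP uu'.
case: (piP presented v) => v' /eqP/presented_eqP vv'.
by apply/eqP/presented_eqP/word_eq_sym/word_eq_cat.
Qed.

Fact presented_invE (u : word) :
  presented_inv (\pi u) = \pi_presented (word_inv u).
Proof.
rewrite /presented_inv; case: (piP presented u) => u' /eqP/presented_eqP uu'.
exact/eqP/presented_eqP/word_eq_sym/word_eq_inv.
Qed.

Fact presented_mulA : associative presented_mul.
Proof.
move=> a b c; rewrite -[a]reprK -[b]reprK -[c]reprK.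
by rewrite !presented_mulE catA.
Qed.

Fact presented_mul1 : left_id presented_one presented_mul.
Proof. by move=> a; rewrite -[a]reprK presented_mulE. Qed.

Fact presented_mul1r : right_id presented_one presented_mul.
Proof. by move=> a; rewrite -[a]reprK presented_mulE cats0. Qed.

Fact presented_mulV : left_inverse presented_one presented_inv presented_mul.
Proof.
move=> a; rewrite -[a]reprK presented_invE presented_mulE.
exact/eqP/presented_eqP/word_eq_Vmul.
Qed.

Fact presented_mulVr : right_inverse presented_one presented_inv presented_mul.
Proof.
move=> a; rewrite -[a]reprK presented_invE presented_mulE.
exact/eqP/presented_eqP/word_eq_mulV.
Qed.

HB.instance Definition _ := isGroup.Build presented
  presented_mulA presented_mul1 presented_mul1r presented_mulV presented_mulVr.

Section Lift.
Variables (H : groupType) (f : X -> H).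

Definition presented_lift (a : presented) : H := word_eval f (repr a).

Hypothesis fR : forall u v, R u v -> word_eval f u = word_eval f v.

Lemma word_eval_eq u v : word_eq u v -> word_eval f u = word_eval f v.
Proof.
elim=> {u v} [//|u v _ -> //|u v w _ -> _ -> //| | |//].
- move=> u u' v v' _ uu' _ vv'.
  by rewrite /word_eval !big_cat /= -!/(word_eval _ _) uu' vv'.
- by move=> x []; rewrite /word_eval !big_cons big_nil /= mulg1 ?mulVg ?mulgV.
Qed.

Lemma presented_lift_pi (u : word) :
  presented_lift (\pi u) = word_eval f u.
Proof.
rewrite /presented_lift; case: (piP presented u) => v /eqP/presented_eqP uv.
by rewrite (word_eval_eq uv).
Qed.

Lemma presented_lift_gen (x : X) : presented_lift (presented_gen x) = f x.
Proof. by rewrite presented_lift_pi /word_eval big_seq1. Qed.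

Lemma presented_lift_mul : {morph presented_lift : a b / a * b}.
Proof.
move=> a b; rewrite -[a]reprK -[b]reprK -[_ * _]/(presented_mul _ _).
by rewrite presented_mulE !presented_lift_pi /word_eval big_cat.
Qed.

End Lift.
End Presentation.

Section CurlyWedge.
Variable G : groupType.

Inductive wedge_rel : word (G * G)%type -> word (G * G)%type -> Prop :=
| wedge_relMl m m' n :
    wedge_rel [:: ((m * m', n), false)]
              [:: ((lconj m m', lconj m n), false); ((m, n), false)]
| wedge_relMr m n n' :
    wedge_rel [:: ((m, n * n'), false)]
              [:: ((m, n), false); ((lconj n m, lconj n n'), false)]
| wedge_rel1 x y : lcomm x y = 1 -> wedge_rel [:: ((x, y), false)] [::].

Definition curly_wedge : Type := presented wedge_rel.
HB.instance Definition _ := Group.on curly_wedge.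

Definition wedge (m n : G) : curly_wedge := presented_gen wedge_rel (m, n).

Definition kappa : curly_wedge -> derived_group G :=
  presented_lift (fun p => dcomm p.1 p.2).

Fact kappa_rel (u v : word (G * G)%type) : wedge_rel u v ->
  word_eval (fun p => dcomm p.1 p.2) u = word_eval (fun p => dcomm p.1 p.2) v.
Proof.
case=> [m m' n|m n n'|x y xy]; rewrite /word_eval ?big_cons big_nil ?mulg1 /=;
  apply: val_inj => //; rewrite valM; [exact: lcommMl | exact: lcommMr].
Qed.

Fact kappaM : {morph kappa : a b / a * b}.
Proof. exact: (presented_lift_mul kappa_rel). Qed.

HB.instance Definition _ :=
  isMultiplicative.Build curly_wedge (derived_group G) kappa kappaM.

Lemma kappa_wedge (x y : G) : kappa (wedge x y) = dcomm x y.
Proof. exact: (presented_lift_gen kappa_rel). Qed.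

Definition kappa_ker : {pred curly_wedge} := [pred w | kappa w == 1].

Fact kappa1 : kappa 1 = 1.
Proof. by apply: (mulgI (kappa 1)); rewrite -kappaM !mulg1. Qed.

Fact kappa_ker_mul : mulg_closed kappa_ker.
Proof. by move=> x y; rewrite !inE kappaM => /eqP-> /eqP->; rewrite mulg1. Qed.

Fact kappa_ker_one : 1 \in kappa_ker.
Proof. by rewrite inE kappa1. Qed.

Fact kappa_ker_inv : invg_closed kappa_ker.
Proof.
move=> x; rewrite !inE => /eqP x1; apply/eqP/(mulgI (kappa x)).
by rewrite -kappaM mulgV kappa1 x1 mulg1.
Qed.

HB.instance Definition _ :=
  isMulClosed.Build curly_wedge kappa_ker kappa_ker_mul.
HB.instance Definition _ :=
  isMul1Closed.Build curly_wedge kappa_ker kappa_ker_one.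
HB.instance Definition _ :=
  isInvClosed.Build curly_wedge kappa_ker kappa_ker_inv.

Definition B0_tilde : Type := subgroup kappa_ker.
HB.instance Definition _ := Group.on B0_tilde.

End CurlyWedge.

Local Open Scope ring_scope.

Section Cohomology.
Variables (G : groupType) (A : zmodType).

Let subBB (p p' q q' : A) : (p - p') - (q - q') = (p - q) - (p' - q').
Proof. by rewrite !opprB [q' - q]addrC addrACA [- p' + q']addrC. Qed.

Let addBB (p p' q q' : A) : (p - p') + (q - q') = (p + q) - (p' + q').
Proof. by rewrite opprD addrACA. Qed.

(* Inhomogeneous cochains of degree two, as curried functions; the action of
   [G] on [A] is trivial. *)
Definition cocycle2 : {pred G -> G -> A} :=
  [pred f | `[< forall x y z : G,
     f y z - f (x * y)%g z + f x (y * z)%g - f x y = 0 >]].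

Lemma cocycle2P (f : G -> G -> A) :
  reflect (forall x y z : G,
     f y z - f (x * y)%g z + f x (y * z)%g - f x y = 0) (f \in cocycle2).
Proof. exact: asboolP. Qed.

Fact cocycle2_closed : zmod_closed cocycle2.
Proof.
split=> [|f g /cocycle2P fZ /cocycle2P gZ]; apply/cocycle2P => x y z.
  by rewrite /= !subr0 addr0.
rewrite -[RHS](subrr 0) -{1}(fZ x y z) -(gZ x y z).
by rewrite -[LHS]/(f y z - g y z - (f (x * y)%g z - g (x * y)%g z) +
  (f x (y * z)%g - g x (y * z)%g) - (f x y - g x y)) subBB addBB subBB.
Qed.

HB.instance Definition _ :=
  GRing.isZmodClosed.Build (G -> G -> A) cocycle2 cocycle2_closed.

Record Z2 : Type := MkZ2 { z2val : G -> G -> A; z2valP : z2val \in cocycle2 }.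

HB.instance Definition _ := [isSub for z2val].
HB.instance Definition _ := [Choice of Z2 by <:].
HB.instance Definition _ := [SubChoice_isSubZmodule of Z2 by <:].

Definition B2 : {pred Z2} :=
  [pred f | `[< exists c : G -> A, forall x y : G,
     z2val f x y = c y - c (x * y)%g + c x >]].

Lemma B2P (f : Z2) :
  reflect (exists c : G -> A, forall x y : G,
     z2val f x y = c y - c (x * y)%g + c x) (f \in B2).
Proof. exact: asboolP. Qed.

Fact B2_closed : zmod_closed B2.
Proof.
split=> [|f g /B2P[c fc] /B2P[d gd]]; apply/B2P.
  by exists (fun=> 0) => x y; rewrite subr0 addr0.
exists (fun x => c x - d x) => x y.
by rewrite subBB addBB -fc -gd.
Qed.

HB.instance Definition _ := GRing.isZmodClosed.Build Z2 B2 B2_closed.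

Definition H2 : Type := Quotient.quot B2.
HB.instance Definition _ := ZmodQuotient.on H2.

End Cohomology.

Section Pullback.
Variables (G H : groupType) (A : zmodType) (f : {multiplicative H -> G}).

Fact pullback_cocycle (u : Z2 G A) :
  (fun x y => z2val u (f x) (f y)) \in @cocycle2 H A.
Proof.
apply/cocycle2P => x y z; rewrite !gmulfM.
by move/cocycle2P: (z2valP u); apply.
Qed.

Definition Z2_pullback (u : Z2 G A) : Z2 H A := MkZ2 (pullback_cocycle u).

Definition H2_pullback (a : H2 G A) : H2 H A :=
  \pi_(H2 H A) (Z2_pullback (repr a)).

Fact H2_pullback_pi (u : Z2 G A) :
  H2_pullback (\pi u) = \pi_(H2 H A) (Z2_pullback u).
Proof.
rewrite /H2_pullback; case: (piP (H2 G A) u) => v /eqP.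
rewrite -Quotient.idealrBE => /B2P[c uvc]; apply/eqP.
rewrite eq_sym -Quotient.idealrBE; apply/B2P; exists (c \o f) => x y.
by rewrite /= gmulfM -uvc.
Qed.

Fact H2_pullback_is_zmod_morphism : zmod_morphism H2_pullback.
Proof.
move=> a b; rewrite -[a]reprK -[b]reprK -raddfB.
by rewrite !H2_pullback_pi -raddfB; congr \pi; apply: val_inj.
Qed.

HB.instance Definition _ :=
  GRing.isZmodMorphism.Build (H2 G A) (H2 H A) H2_pullback
    H2_pullback_is_zmod_morphism.

End Pullback.

Definition integers : {pred rat} := [pred q : rat | q \is a Num.int].

Fact integers_closed : zmod_closed integers.
Proof. by split=> [|p q pZ qZ]; [exact: rpred0 | exact: rpredB]. Qed.

HB.instance Definition _ :=
  GRing.isZmodClosed.Build rat integers integers_closed.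

Definition QmodZ : Type := Quotient.quot integers.
HB.instance Definition _ := ZmodQuotient.on QmodZ.

Section Bogomolov.
Variable G : groupType.

Definition res (S : groupClosed G) :
  {additive H2 G QmodZ -> H2 (subgroup S) QmodZ} :=
  H2_pullback (val : {multiplicative subgroup S -> G}).

Definition bogomolov : {pred H2 G QmodZ} :=
  [pred a | `[< forall S : groupClosed G,
     {in S &, forall x y : G, (x * y = y * x)%g} -> res S a = 0 >]].

Lemma bogomolovP (a : H2 G QmodZ) :
  reflect (forall S : groupClosed G,
    {in S &, forall x y : G, (x * y = y * x)%g} -> res S a = 0)
    (a \in bogomolov).
Proof. exact: asboolP. Qed.

Fact bogomolov_closed : zmod_closed bogomolov.
Proof.
split=> [|a b /bogomolovP aB /bogomolovP bB]; apply/bogomolovP => S abS.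
  by rewrite raddf0.
by rewrite raddfB aB ?bB ?subr0.
Qed.

HB.instance Definition _ :=
  GRing.isZmodClosed.Build (H2 G QmodZ) bogomolov bogomolov_closed.

Record B0 : Type := MkB0 { B0val : H2 G QmodZ; B0valP : B0val \in bogomolov }.

HB.instance Definition _ := [isSub for B0val].
HB.instance Definition _ := [Choice of B0 by <:].
HB.instance Definition _ := [SubChoice_isSubZmodule of B0 by <:].

End Bogomolov.

(* Main.v *)
Require Import Defs.
From HB Require Import structures.
From mathcomp Require Import all_boot all_algebra.
From mathcomp Require Import ring_quotient.
From mathcomp Require Import boolp classical_sets cardinality.

(** Isoclinic groups [G1] and [G2] have a common cover.  Let [P] be the fibre
product of [G1] and [G2] over the identification [alpha] of their central
quotients.  The compatibility of [alpha] with [beta] says that the derived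
subgroup of [P] lies in the graph of [beta]; since [beta] is bijective, each
projection of [P] onto [G1] or [G2] is a surjection whose kernel meets
[[P, P]] trivially ([fibre_fst_epi], [fibre_snd_epi]).  So it is enough to show
that a surjection [pi : P -> G] of this kind preserves both invariants.  Two
consequences of the hypothesis on [pi] are used all along: its kernel [N] is
central, and elements of [P] commute as soon as their images do
([epi_commute]).

For B0~, the wedge of [x] and [y] is unchanged when [x] and [y] are multiplied
by central elements ([wedge_centralM]), and commuting pairs correspond under
[pi].  Hence a set-theoretic section of [pi] induces an inverse of the
homomorphism from the curly wedge of [P] to that of [G] ([epi_curly_wedge]).
This isomorphism is compatible with the two maps [kappa] and with the injective
map that [pi] induces on derived subgroups, so it matches the kernels.

For B0, inflation along [pi] is shown to be bijective on cocycle classes.  The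
key input is that a homomorphism from [N] to Q/Z extends to [P]: indeed [N]
embeds in the abelianization of [P], and divisible groups are injective
([epi_hom_extend]).
- If the inflation of a cocycle [f] is the coboundary of [c], then [c] is a
  homomorphism on [N] up to a constant; subtracting an extension of it to [P]
  makes [c] constant on the cosets of [N], so [f] is a coboundary
  ([epi_coboundary_descend]).
- If the class of [u] is in B0(P), then [u] is symmetric on commuting pairs, and
  its restriction to the center is a coboundary.  Then [u] can be corrected by
  a coboundary so that it vanishes as soon as one argument is in [N]
  ([epi_trivialize_kernel]); such a cocycle factors through [pi]
  ([cocycle2_factor]).
- Abelian subgroups of [G] have abelian preimages, and abelian subgroups of [P]
  have abelian images, so that B0(P) and B0(G) correspond
  ([inflation_bogomolov], [bogomolov_inflation]). *)

Set Implicit Arguments.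
Unset Strict Implicit.
Unset Printing Implicit Defensive.

Import GRing.Theory.

Local Open Scope group_scope.
Local Open Scope quotient_scope.

(** * Surjections whose kernel avoids the derived subgroup *)

(** These are the surjections that induce an isoclinism between source and
target. *)
Definition isoclinic_epi (P G : groupType) (pi : {multiplicative P -> G}) :=
  (forall g, exists p, pi p = g) /\
  (forall p, p \in @derived P -> pi p = 1 -> p = 1).

Lemma lcomm_eq1 (G : groupType) (x y : G) : lcomm x y = 1 <-> x * y = y * x.
Proof.
rewrite /lcomm; split=> [/divg1_eq xy|->]; last by rewrite mulgK mulgV.
by rewrite -{1}[x * y](mulgVK x) xy.
Qed.

Lemma multiplicative1 (G H : groupType) (f : {multiplicative G -> H}) :
  f 1 = 1.
Proof. by apply: (mulgI (f 1)); rewrite -gmulfM !mulg1. Qed.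

Lemma multiplicativeV (G H : groupType) (f : {multiplicative G -> H}) :
  {morph f : x / x^-1}.
Proof.
by move=> x; apply: (mulgI (f x)); rewrite -gmulfM !mulgV multiplicative1.
Qed.

Section EpiTheory.
Variables (P G : groupType) (pi : {multiplicative P -> G}).
Hypothesis pi_epi : isoclinic_epi pi.

Lemma gmulf_lcomm (x y : P) : pi (lcomm x y) = lcomm (pi x) (pi y).
Proof. by rewrite /lcomm !gmulfM !multiplicativeV. Qed.

(** The commutator of [x] and [y] is a derived element of the kernel. *)
Lemma epi_commute (x y : P) : pi x * pi y = pi y * pi x -> x * y = y * x.
Proof.
move=> /lcomm_eq1 xy; apply/lcomm_eq1; apply: pi_epi.2 (lcomm_derived x y) _.
by rewrite gmulf_lcomm.
Qed.

Lemma epi_ker_central (n x : P) : pi n = 1 -> n * x = x * n.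
Proof. by move=> n1; apply: epi_commute; rewrite n1 mul1g mulg1. Qed.

Lemma epi_section : {s : G -> P | cancel s pi}.
Proof. by have [s sK] := choice pi_epi.1; exists s. Qed.

Lemma epi_fiber (x y : P) : pi x = pi y -> pi (x^-1 * y) = 1.
Proof. by rewrite gmulfM multiplicativeV => ->; rewrite mulVg. Qed.

End EpiTheory.

Local Open Scope ring_scope.

(** * Extension of homomorphisms to divisible groups *)

Definition divisible (A : zmodType) :=
  forall (a : A) n, (0 < n)%N -> exists b, b *+ n = a.

Lemma QmodZ_divisible : divisible QmodZ.
Proof.
move=> a n n0; exists (\pi_QmodZ (repr a / n%:R)).
rewrite -raddfMn /= -[RHS]reprK; congr \pi.
by rewrite -[LHS]mulr_natr divfK // Num.Theory.pnatr_eq0 -lt0n.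
Qed.

Section Extension.
Variables (P : groupType) (A : zmodType).

(** Homomorphisms to [A] from subgroups of [P] containing [[P, P]], and trivial
on it, represented by their graphs so that Zorn's lemma applies to inclusion.
Triviality on [[P, P]] lets [P] behave as its abelianization. *)
Record partial_hom (S : set (P * A)) : Prop := PartialHom {
  partial_homF : forall x u y v,
    S (x, u) -> S (y, v) -> S ((x * y^-1)%g, u - v);
  partial_hom1 : forall u, S (1%g, u) -> u = 0;
  partial_hom_derived : forall d, d \in @derived P -> S (d, 0) }.

Section PartialHomTheory.
Variables (S : set (P * A)) (homS : partial_hom S).

Lemma partial_hom0 : S (1%g, 0).
Proof. by apply: (partial_hom_derived homS); apply: gpred1. Qed.

Lemma partial_homV x u : S (x, u) -> S (x^-1%g, - u).
Proof.
by move=> /(partial_homF homS partial_hom0); rewrite mul1g sub0r.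
Qed.

Lemma partial_homM x u y v : S (x, u) -> S (y, v) -> S ((x * y)%g, u + v).
Proof.
by move=> xu /partial_homV /(partial_homF homS xu); rewrite invgK opprK.
Qed.

Lemma partial_hom_functional x u v : S (x, u) -> S (x, v) -> u = v.
Proof.
move=> xu /(partial_homF homS xu); rewrite mulgV => /(partial_hom1 homS).
exact: subr0_eq.
Qed.

Lemma partial_homX x u k : S (x, u) -> S ((x ^+ k)%g, u *+ k).
Proof.
move=> xu; elim: k => [|k IHk]; first exact: partial_hom0.
by rewrite expgS mulrS; apply: partial_homM.
Qed.

Lemma partial_hom_swap x y z u : S ((x * y * z)%g, u) -> S ((y * x * z)%g, u).
Proof.
move=> /(partial_homM (partial_hom_derived homS (lcomm_derived y x))).
by rewrite add0r /lcomm !mulgA !mulgVK.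
Qed.

(** A value [q] at [x] is compatible with [S] as soon as it is compatible at
the least positive power of [x] in the domain, since the exponents of the other
powers in the domain are multiples of that one.  Divisibility of [A] provides
[q]. *)
Lemma partial_hom_slope x : divisible A ->
  exists q, forall k v, S ((x ^+ k)%g, v) -> v = q *+ k.
Proof.
move=> divA.
have [[k0 [k0_gt0 [v0 Sv0]]]|nok] :=
    pselect (exists k, (0 < k)%N /\ exists v, S ((x ^+ k)%g, v)); last first.
  exists 0 => -[|k] v Sv; first by rewrite mulr0n; exact: (partial_hom1 homS).
  by case: nok; exists k.+1; split=> //; exists v.
pose good k := (0 < k)%N && `[< exists v, S ((x ^+ k)%g, v) >].
have exg : exists k, good k.
  by exists k0; rewrite /good k0_gt0; apply/asboolP; exists v0.
have [m /andP[m_gt0 /asboolP[w Sw]] minm] := ex_minnP exg.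
have [q qw] := divA w m m_gt0; exists q => k v Sv.
have Sr : S ((x ^+ (k %% m))%g, v - w *+ (k %/ m)).
  have := partial_homF homS Sv (partial_homX (k %/ m) Sw).
  rewrite -expgnA mulnC -expgnFr ?leq_trunc_div //.
  by rewrite {1}(divn_eq k m) addKn.
have [r0|r_gt0] := posnP (k %% m)%N; last first.
  have /minm : good (k %% m)%N.
    by rewrite /good r_gt0; apply/asboolP; exists (v - w *+ (k %/ m)).
  by rewrite leqNgt ltn_mod m_gt0.
move: Sr; rewrite r0 expg0 => /(partial_hom1 homS) /subr0_eq ->.
by rewrite -qw -mulrnA mulnC {2}(divn_eq k m) r0 addn0.
Qed.

Lemma partial_hom_adjoin x : divisible A ->
  exists T, [/\ partial_hom T, (S `<=` T)%classic & exists w, T (x, w)].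
Proof.
move=> divA; have [q qP] := partial_hom_slope x divA.
(* The extension sends [x] to [q]; the integer exponent of [x] is written as
   a difference of two naturals. *)
pose T (p : P * A) := exists a b : nat,
  S ((x ^+ a * p.1 * x ^- b)%g, p.2 + (q *+ a - q *+ b)).
have ST : (S `<=` T)%classic.
  by move=> -[y w] Syw; exists 0, 0; rewrite /= !expg0 mul1g divg1 subrr addr0.
exists T; split=> //; last first.
  exists q, 0, 1%N => /=.
  by rewrite expg0 mul1g expg1 mulgV mulr0n sub0r subrr; apply: partial_hom0.
split.
- move=> y u z v [a [b Sy]] [a' [b' Sz]]; exists (a + b')%N, (b + a')%N => /=.
  have := partial_homF homS Sy Sz; rewrite /= !invgM invgK !expgnDr.
  have -> : (u + (q *+ a - q *+ b) - (v + (q *+ a' - q *+ b')) =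
      u - v + (q *+ (a + b') - q *+ (b + a')))%R.
    by rewrite opprD addrACA !mulrnDr opprB (addrACA (q *+ a)) -opprD.
  move=> Syz; set U := (_ - _ + _)%R in Syz *.
  (* The letters are rotated one block at a time: first x ^+ b' to the front,
     then x ^- b to the front, and finally x ^- b to the end. *)
  have := @partial_hom_swap (x ^+ a * y * x ^- b) (x ^+ b') (z^-1 * x ^- a') U.
  rewrite !mulgA in Syz * => /(_ Syz) Syz1.
  have := @partial_hom_swap (x ^+ b' * x ^+ a * y) (x ^- b) (z^-1 * x ^- a') U.
  rewrite !mulgA => /(_ Syz1) Syz2.
  have := @partial_hom_swap (x ^- b)
    (x ^+ b' * x ^+ a * y * z^-1 * x ^- a') 1 U.
  rewrite !mulg1 !mulgA => /(_ Syz2).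
  by rewrite -(expgnDr x b' a) (addnC b' a) expgnDr invgM !mulgA.
- move=> u [a [b]] /=; rewrite mulg1 => Su.
  have [ba|/ltnW ab] := leqP b a.
    move: Su; rewrite -expgnFr // => /qP/eqP.
    by rewrite mulrnBr // -subr_eq0 addrK => /eqP.
  have := partial_homV Su; rewrite invgF -expgnFr // => /qP/eqP.
  by rewrite mulrnBr // opprD opprB -subr_eq0 addrK oppr_eq0 => /eqP.
- by move=> d dP; apply: ST; apply: partial_hom_derived.
Qed.

End PartialHomTheory.

Local Open Scope classical_set_scope.

(** Zorn's lemma gives a maximal extension, which is total by
[partial_hom_adjoin]. *)
Lemma partial_hom_extend (S : set (P * A)) : divisible A -> partial_hom S ->
  exists f : P -> A,
    (forall x y, f (x * y)%g = f x + f y) /\ (forall x u, S (x, u) -> f x = u).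
Proof.
move=> divA homS.
(* The empty set has to satisfy [extends], being the union of the empty
   chain. *)
pose extends (X : set (P * A)) := X !=set0 -> S `<=` X /\ partial_hom X.
have S0 : S !=set0 by exists (1%g, 0); exact: partial_hom0.
have [F FE Ftot|M [ME maxM]] := @Zorn_bigcup _ extends.
  have FP X p : F X -> X p -> S `<=` X /\ partial_hom X.
    by move=> FX Xp; apply: (FE _ FX); exists p.
  move=> [p0 [X0 FX0 X0p0]]; split=> [p Sp|].
    by exists X0 => //; apply: (FP _ _ FX0 X0p0).1.
  split.
  - move=> x u y v [X FX Xx] [Y FY Yy].
    have [XY|YX] := Ftot _ _ FX FY.
      by exists Y => //; apply: partial_homF (FP _ _ FY Yy).2 _ _ _ _ _ _ => //;
         exact: XY.
    by exists X => //; apply: partial_homF (FP _ _ FX Xx).2 _ _ _ _ _ _ => //;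
       exact: YX.
  - by move=> u [X FX Xu]; apply: partial_hom1 (FP _ _ FX Xu).2 _ Xu.
  - move=> d dP; exists X0 => //.
    exact: partial_hom_derived (FP _ _ FX0 X0p0).2 _ dP.
have maxP X : M `<=` X -> S `<=` X -> partial_hom X -> X `<=` M.
  move=> MX SX homX; apply: contrapT => XM.
  by apply: (maxM X) => // _; split.
have M0 : M !=set0.
  apply: contrapT => M0; apply: (maxM S) => [|_]; last by split.
  split=> [p Mp|SM]; first by case: M0; exists p.
  by have [p Sp] := S0; case: M0; exists p; exact: SM.
have [SM homM] := ME M0.
have /choice[f fM] x : exists w, M (x, w).
  have [T [homT MT [w Tw]]] := partial_hom_adjoin homM x divA.
  by exists w; apply: (maxP T) => //; apply: subset_trans MT.
exists f; split=> [x y|x u Sxu].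
  exact: (partial_hom_functional homM (fM _)
            (partial_homM homM (fM x) (fM y))).
exact: (partial_hom_functional homM (fM x) (SM _ Sxu)).
Qed.

End Extension.

Section EpiExtension.
Variables (P G : groupType) (pi : {multiplicative P -> G}) (A : zmodType).
Hypotheses (pi_epi : isoclinic_epi pi) (divA : divisible A).

(** On the subgroup generated by [[P, P]] and the kernel, [d * n |-> c n] is
well defined because the kernel meets [[P, P]] trivially. *)
Lemma epi_hom_extend (c : P -> A) :
  (forall n m, pi n = 1%g -> pi m = 1%g -> c (n * m)%g = c n + c m) ->
  exists f : P -> A,
    (forall x y, f (x * y)%g = f x + f y) /\
    (forall n, pi n = 1%g -> f n = c n).
Proof.
move=> cM.
have pi1 := multiplicative1 pi; have piV := multiplicativeV pi.
have c1 : c 1%g = 0.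
  by apply: (addIr (c 1%g)); rewrite -cM // mulg1 add0r.
have cV n : pi n = 1%g -> c n^-1%g = - c n.
  move=> n1; apply: (addIr (c n)).
  by rewrite addNr -cM ?mulVg // piV n1 invg1.
pose S (p : P * A) := exists d n, [/\ d \in @derived P, pi n = 1%g &
  p = ((d * n)%g, c n)].
have homS : partial_hom S.
  split=> [x u y v|u|d dP]; last 1 first.
  - by exists d, 1%g; rewrite mulg1 c1.
  - move=> [d [n [dP n1 [-> ->]]]] [d' [n' [d'P n'1 [-> ->]]]].
    have V1 : pi n'^-1%g = 1%g by rewrite piV n'1 invg1.
    have nV1 : pi (n * n'^-1)%g = 1%g by rewrite gmulfM n1 V1 mulg1.
    exists (d * d'^-1)%g, (n * n'^-1)%g.
    rewrite gpredF // cM // cV //; split=> //; congr (_, _).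
    by rewrite invgM -!mulgA (mulgA n) (epi_ker_central pi_epi _ nV1).
  - move=> [d [n [dP n1 [dn ->]]]]; suff -> : n = 1%g by [].
    apply: pi_epi.2 n1.
    by rewrite -(mulg1_eq (esym dn)) gpredV.
have [f [fM fS]] := partial_hom_extend divA homS; exists f; split=> // n n1.
by apply: fS; exists 1%g, n; rewrite mul1g gpred1.
Qed.
End EpiExtension.

(** * Cocycles and coboundaries *)

Definition coboundary (G : groupType) (A : zmodType) (c : G -> A) (x y : G) :=
  c y - c (x * y)%g + c x.

Section Cocycles.
Variables (G : groupType) (A : zmodType).
Implicit Types (f : G -> G -> A) (c : G -> A).

Lemma cocycle2_addP f :
  reflect (forall x y z, f y z + f x (y * z)%g = f (x * y)%g z + f x y)
    (f \in @cocycle2 G A).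
Proof.
have fE x y z : (f y z - f (x * y)%g z + f x (y * z)%g - f x y == 0) =
    (f y z + f x (y * z)%g == f (x * y)%g z + f x y).
  by rewrite subr_eq0 addrAC subr_eq [f x y + _]addrC.
apply: (iffP (cocycle2P f)) => fZ x y z; apply/eqP.
  by rewrite -fE fZ.
by rewrite fE fZ.
Qed.

Lemma cocycle2_r1 f x : f \in @cocycle2 G A -> f x 1%g = f 1%g 1%g.
Proof.
by move=> /cocycle2_addP/(_ x 1%g 1%g); rewrite !mulg1 => /addIr.
Qed.

Lemma coboundaryB c d x y :
  coboundary (fun z => c z - d z) x y = coboundary c x y - coboundary d x y.
Proof.
rewrite /coboundary (opprD (c _)) [X in X + _ = _]addrACA -opprD.
by rewrite addrACA -opprD.
Qed.

Lemma coboundary_hom c x y : (forall x y, c (x * y)%g = c x + c y) ->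
  coboundary c x y = 0.
Proof.
by move=> cM; rewrite /coboundary cM opprD addrCA subrr addr0 addNr.
Qed.

Lemma coboundary_cocycle2 c : coboundary c \in @cocycle2 G A.
Proof.
apply/cocycle2P => x y z; rewrite /coboundary mulgA.
apply/eqP; rewrite subr_eq0 addrAC subr_eq; apply/eqP.
rewrite addrAC -[_ - _ + c x]addrA subrKA addrA [in RHS](addrAC (c y)).
by rewrite (addrC _ (c (x * y)%g)) subrKA [RHS]addrC (addrC (c y)) addrA.
Qed.

Lemma H2_pi_eqP (u v : Z2 G A) :
  \pi_(H2 G A) u = \pi v <->
  exists c, forall x y, z2val u x y - z2val v x y = coboundary c x y.
Proof.
split=> [/eqP|[c uv]]; last apply/eqP.
  by rewrite -Quotient.idealrBE => /B2P.
by rewrite -Quotient.idealrBE; apply/B2P; exists c.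
Qed.

Lemma H2_pi0P (u : Z2 G A) :
  \pi_(H2 G A) u = 0 <-> exists c, forall x y, z2val u x y = coboundary c x y.
Proof.
rewrite -(raddf0 \pi_(H2 G A)) H2_pi_eqP.
by split=> -[c uc]; exists c => x y; rewrite -uc subr0.
Qed.

End Cocycles.

(** * Classes that vanish on abelian subgroups *)

Section GroupClosedConstructions.
Variables (P G : groupType) (f : {multiplicative P -> G}).

Section Image.
Variable S : groupClosed P.

Definition image_pred : {pred G} :=
  [pred g | `[< exists2 x, x \in S & f x = g >]].

Lemma image_predP g : reflect (exists2 x, x \in S & f x = g) (g \in image_pred).
Proof. exact: asboolP. Qed.

Fact image_pred_mul : mulg_closed image_pred.
Proof.
move=> g h /image_predP[x xS <-] /image_predP[y yS <-]; apply/image_predP.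
by exists (x * y)%g; rewrite ?gmulfM // gpredM.
Qed.

Fact image_pred_one : 1%g \in image_pred.
Proof. by apply/image_predP; exists 1%g; rewrite ?multiplicative1 ?gpred1. Qed.

Fact image_pred_inv : invg_closed image_pred.
Proof.
move=> g /image_predP[x xS <-]; apply/image_predP.
by exists x^-1%g; rewrite ?multiplicativeV ?gpredV.
Qed.

HB.instance Definition _ := isMulClosed.Build G image_pred image_pred_mul.
HB.instance Definition _ := isMul1Closed.Build G image_pred image_pred_one.
HB.instance Definition _ := isInvClosed.Build G image_pred image_pred_inv.
End Image.

Section Preimage.
Variable S : groupClosed G.

Definition preimage_pred : {pred P} := [pred x | f x \in S].

Fact preimage_pred_mul : mulg_closed preimage_pred.
Proof. by move=> x y xS yS; rewrite inE gmulfM gpredM. Qed.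

Fact preimage_pred_one : 1%g \in preimage_pred.
Proof. by rewrite inE multiplicative1 gpred1. Qed.

Fact preimage_pred_inv : invg_closed preimage_pred.
Proof. by move=> x xS; rewrite inE multiplicativeV gpredV. Qed.

HB.instance Definition _ :=
  isMulClosed.Build P preimage_pred preimage_pred_mul.
HB.instance Definition _ :=
  isMul1Closed.Build P preimage_pred preimage_pred_one.
HB.instance Definition _ :=
  isInvClosed.Build P preimage_pred preimage_pred_inv.
End Preimage.
End GroupClosedConstructions.

Section Bicentralizer.
Variables (G : groupType) (x y : G).

(** When [x] and [y] commute, this is an abelian subgroup containing both, given
without mention of words in [x] and [y]. *)
Definition bicentralizer : {pred G} :=
  [pred g | `[< forall h, (h * x = x * h)%g -> (h * y = y * h)%g ->
                  (h * g = g * h)%g >]].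

Lemma bicentralizerP g :
  reflect (forall h, (h * x = x * h)%g -> (h * y = y * h)%g ->
             (h * g = g * h)%g) (g \in bicentralizer).
Proof. exact: asboolP. Qed.

Fact bicentralizer_mul : mulg_closed bicentralizer.
Proof.
move=> g g' /bicentralizerP gC /bicentralizerP g'C.
by apply/bicentralizerP => h hx hy; rewrite mulgA gC // -!mulgA g'C.
Qed.

Fact bicentralizer_one : 1%g \in bicentralizer.
Proof. by apply/bicentralizerP => h _ _; rewrite mul1g mulg1. Qed.

Fact bicentralizer_inv : invg_closed bicentralizer.
Proof.
move=> g /bicentralizerP gC; apply/bicentralizerP => h hx hy.
by apply: (mulgI g); rewrite mulVKg mulgA -gC // mulgK.
Qed.

HB.instance Definition _ := isMulClosed.Build G bicentralizer bicentralizer_mul.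
HB.instance Definition _ :=
  isMul1Closed.Build G bicentralizer bicentralizer_one.
HB.instance Definition _ := isInvClosed.Build G bicentralizer bicentralizer_inv.

Lemma bicentralizer_l : x \in bicentralizer.
Proof. exact/bicentralizerP. Qed.

Lemma bicentralizer_r : y \in bicentralizer.
Proof. exact/bicentralizerP. Qed.

Lemma bicentralizer_abelian : (x * y = y * x)%g ->
  {in bicentralizer &, forall g h, (g * h = h * g)%g}.
Proof.
move=> xy g h /bicentralizerP gC /bicentralizerP hC.
by apply: hC; symmetry; apply: gC.
Qed.
End Bicentralizer.

Section BogomolovCriterion.
Variable G : groupType.
Implicit Type u : Z2 G QmodZ.

Lemma bogomolov_piP u :
  \pi_(H2 G QmodZ) u \in @bogomolov G <->
  forall S : groupClosed G, {in S &, forall x y, (x * y = y * x)%g} ->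
  exists c, {in S &, forall x y, z2val u x y = coboundary c x y}.
Proof.
have resP (S : groupClosed G) : res S (\pi u) = 0 <->
    exists c, {in S &, forall x y, z2val u x y = coboundary c x y}.
  rewrite /res /= H2_pullback_pi H2_pi0P; split=> -[c uc].
    pose c' x := if insub x is Some p then c p else 0.
    have c'E (p : subgroup S) : c' (val p) = c p by rewrite /c' valK.
    exists c' => x y xS yS.
    have := uc (Subgroup xS) (Subgroup yS).
    by rewrite /coboundary -!c'E valM.
  by exists (c \o val) => x y; exact: uc (valP x) (valP y).
split=> [/bogomolovP uB S /uB/resP //|uS].
by apply/bogomolovP => S /uS/resP.
Qed.

(** Coboundaries are symmetric on commuting pairs, and a commuting pair lies in
an abelian subgroup. *)
Lemma bogomolov_symmetric u x y : \pi_(H2 G QmodZ) u \in @bogomolov G ->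
  (x * y = y * x)%g -> z2val u x y = z2val u y x.
Proof.
move=> /bogomolov_piP uB xy.
have [c uc] := uB (bicentralizer x y) (bicentralizer_abelian xy).
rewrite !uc ?bicentralizer_l ?bicentralizer_r // /coboundary xy.
by rewrite addrAC [in RHS]addrAC (addrC (c x)).
Qed.
End BogomolovCriterion.

(** * Inflation is bijective on B0 *)

Section Inflation.
Variables (P G : groupType) (pi : {multiplicative P -> G}).
Hypothesis pi_epi : isoclinic_epi pi.

Section Coefficients.
Variable A : zmodType.

(** The descent is stated over a part [T] of [G] in order to cover both the
injectivity of inflation ([T] is everything) and the vanishing on abelian
subgroups of [G]. *)
Lemma epi_coboundary_descend (T : {pred G}) (f : G -> G -> A) (c : P -> A) :
  divisible A -> f \in @cocycle2 G A -> 1%g \in T -> mulg_closed T ->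
  (forall x y, pi x \in T -> pi y \in T ->
     f (pi x) (pi y) = coboundary c x y) ->
  exists c', {in T &, forall g h, f g h = coboundary c' g h}.
Proof.
move=> divA fZ T1 TM fc; have [s sK] := epi_section pi_epi.
(* On cosets of the kernel, [c] varies as the homomorphism
   [n |-> c n - f 1 1]; the constant comes from [f g 1 = f 1 1]. *)
have fcN x n : pi x \in T -> pi n = 1%g ->
    c (x * n)%g = c x + (c n - f 1%g 1%g).
  move=> xT n1; rewrite -(cocycle2_r1 (pi x) fZ) -n1 fc ?n1 //.
  by rewrite opprD opprB [X in _ + X]addrA (addrC (c n)) subrK [RHS]addrC subrK.
have [|chi [chiM chiN]] :=
    epi_hom_extend pi_epi divA (c := fun n => c n - f 1%g 1%g).
  by move=> n m n1 m1; rewrite fcN ?n1 // addrAC.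
exists (fun g => c (s g) - chi (s g)) => g h gT hT.
have ghT := TM _ _ gT hT.
have [n n1 def_gh] : exists2 n, pi n = 1%g & (s g * s h = s (g * h)%g * n)%g.
  exists ((s (g * h)%g)^-1 * (s g * s h))%g; last by rewrite mulVKg.
  by apply: epi_fiber; rewrite gmulfM !sK.
rewrite -{1}(sK g) -{1}(sK h) fc ?sK // -[LHS]subr0.
rewrite -(coboundary_hom (s g) (s h) chiM) -coboundaryB /coboundary def_gh.
by rewrite fcN ?sK // chiM (chiN n n1) (addrC (chi _)) addrKA.
Qed.

(** In the extension of [P] by [A] defined by [f], the hypothesis on [c]
splits the preimage of the kernel.  Decompose [p] as [s * nu] with [s] the
chosen representative of its coset and [nu] in the kernel, and lift [p] to the
product of a lift of [s] by the split lift of [nu].  This choice of lifts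
changes [f] by a coboundary; it commutes with right multiplication by kernel
elements, so the changed cocycle vanishes at [(p, n)] for [n] in the kernel. *)
Lemma epi_trivialize_kernel (f : P -> P -> A) (c : P -> A) :
  f \in @cocycle2 P A ->
  (forall n m, pi n = 1%g -> pi m = 1%g -> f n m = coboundary c n m) ->
  exists b, forall p n, pi n = 1%g -> f p n = coboundary b p n.
Proof.
move=> fZ fc; have [s sK] := epi_section pi_epi.
pose nu p := ((s (pi p))^-1 * p)%g.
have nu1 p : pi (nu p) = 1%g by apply: epi_fiber; rewrite sK.
(* The constant [c (s 1)] compensates for [s 1] being possibly different from 1,
   so that [b] agrees with [c] on the kernel. *)
pose b p := c (s 1%g) + c (nu p) - f (s (pi p)) (nu p).
have piM p n : pi n = 1%g -> pi (p * n)%g = pi p.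
  by move=> n1; rewrite gmulfM n1 mulg1.
have bN n : pi n = 1%g -> b n = c n.
  move=> n1; rewrite /b n1 fc ?sK //.
  rewrite /coboundary /nu n1 mulVKg (addrC (c (s _))).
  by rewrite opprD opprB addrACA subrr addr0 addrC subrK.
exists b => p n n1.
have /cocycle2_addP/(_ (s (pi p)) (nu p) n) := fZ.
rewrite {3}/nu mulVKg => /esym/(canRL (addrK _)) ->.
have bM : b (p * n)%g =
    c (s 1%g) + c (nu p * n)%g - f (s (pi p)) (nu p * n)%g.
  by rewrite /b /nu piM // mulgA.
rewrite (fc _ _ (nu1 p) n1) /coboundary bN // bM /b -!addrA; congr (_ + _).
rewrite [RHS]addrC (addrC (c (s 1%g)) (c (nu p) - _)) addrKA opprB.
by rewrite [RHS]addrACA [RHS]addrA addrC (addrA (c _)).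
Qed.

(** By the cocycle identity, vanishing on the kernel makes [v] invariant under
multiplication of either argument by a kernel element. *)
Lemma cocycle2_factor (v : P -> P -> A) : v \in @cocycle2 P A ->
  (forall p n, pi n = 1%g -> v p n = 0) ->
  (forall p n, pi n = 1%g -> v n p = 0) ->
  exists2 w, w \in @cocycle2 G A & forall p q, v p q = w (pi p) (pi q).
Proof.
move=> vZ vr vl; have [s sK] := epi_section pi_epi.
have /cocycle2_addP vE := vZ.
have vMr p q n : pi n = 1%g -> v p (q * n)%g = v p q.
  move=> n1; move: (vE p q n).
  by rewrite (vr q n n1) (vr (p * q)%g n n1) !add0r.
have vMl p q n : pi n = 1%g -> v (p * n)%g q = v p q.
  move=> n1; move: (vE p n q).
  rewrite (vl q n n1) (vr p n n1) add0r addr0 => <-.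
  by rewrite (epi_ker_central pi_epi) // vMr.
pose w g h := v (s g) (s h).
have vw p q : v p q = w (pi p) (pi q).
  have fib x : pi ((s (pi x))^-1 * x)%g = 1%g by apply: epi_fiber; rewrite sK.
  rewrite -{1}[p](mulVKg (s (pi p))) -{1}[q](mulVKg (s (pi q))).
  by rewrite vMl // vMr.
exists w => //; apply/cocycle2_addP => g h k.
by rewrite -(sK g) -(sK h) -(sK k) -!gmulfM -!vw.
Qed.

End Coefficients.

Lemma inflation_inj (A : zmodType) (a : H2 G A) : divisible A ->
  H2_pullback pi a = 0 -> a = 0.
Proof.
move=> divA; rewrite -[a]reprK H2_pullback_pi => /H2_pi0P[c uc].
have [//|c' uc'] := epi_coboundary_descend (T := predT) (c := c)
  divA (z2valP (repr a)) isT _ (fun x y _ _ => uc x y).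
by apply/H2_pi0P; exists c' => g h; exact: uc'.
Qed.

Lemma inflation_bogomolov (a : H2 G QmodZ) :
  a \in @bogomolov G -> H2_pullback pi a \in @bogomolov P.
Proof.
rewrite -[a]reprK H2_pullback_pi => /bogomolov_piP aB.
apply/bogomolov_piP => S abS.
have [|c ac] := aB (image_pred pi S).
  move=> g h /image_predP[x xS <-] /image_predP[y yS <-].
  by rewrite -!gmulfM abS.
exists (c \o pi) => x y xS yS; rewrite /coboundary /= gmulfM.
by apply: ac; apply/image_predP; [exists x | exists y].
Qed.

(** The center of [P] is an abelian subgroup containing the kernel, so that a
class in B0(P) restricts trivially to the kernel. *)
Lemma bogomolov_inflation (b : H2 P QmodZ) : b \in @bogomolov P ->
  exists2 a, a \in @bogomolov G & H2_pullback pi a = b.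
Proof.
rewrite -[b]reprK; move: (repr b) => u {b} uB.
have [c uc] : exists c, forall n m, pi n = 1%g -> pi m = 1%g ->
    z2val u n m = coboundary c n m.
  have /bogomolov_piP/(_ (@center P))[|c uc] := uB.
    by move=> x y /centerP xZ _; exact: xZ.
  exists c => n m n1 m1.
  by apply: uc; apply/centerP => x; apply: (epi_ker_central pi_epi).
have [d ud] := epi_trivialize_kernel (z2valP u) uc.
pose v : Z2 P QmodZ := u - MkZ2 (coboundary_cocycle2 d).
have vE x y : z2val v x y = z2val u x y - coboundary d x y by [].
have def_b : \pi_(H2 P QmodZ) u = \pi v.
  by apply/H2_pi_eqP; exists d => x y; rewrite vE opprB addrC subrK.
rewrite def_b in uB *.
have vr p n : pi n = 1%g -> z2val v p n = 0.
  by move=> n1; rewrite vE ud // subrr.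
have vl p n : pi n = 1%g -> z2val v n p = 0.
  move=> n1; rewrite (bogomolov_symmetric uB) ?vr //.
  exact: (epi_ker_central pi_epi).
have [w wZ vw] := cocycle2_factor (z2valP v) vr vl.
exists (\pi_(H2 G QmodZ) (MkZ2 wZ)); last first.
  rewrite H2_pullback_pi; congr \pi; apply: val_inj => /=.
  by apply/funext => x; apply/funext => y; exact: esym (vw x y).
apply/bogomolov_piP => S abS.
have /bogomolov_piP/(_ (preimage_pred pi S))[|c' vc'] := uB.
  by move=> x y xS yS; apply: (epi_commute pi_epi); exact: abS.
apply: (epi_coboundary_descend (c := c') QmodZ_divisible wZ).
- exact: gpred1.
- by move=> x y; exact: gpredM.
- by move=> x y xS yS; rewrite -vw vc'.
Qed.

End Inflation.

(** * Isomorphism is an equivalence relation *)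

Local Open Scope group_scope.

Lemma inj_surj_bijective (A B : Type) (f : A -> B) :
  injective f -> (forall b, exists a, f a = b) -> bijective f.
Proof.
move=> fI /choice[g gK]; exists g => // a.
by apply: fI; rewrite gK.
Qed.

Lemma isomorphicI (G H : groupType) (f : G -> H) :
  {morph f : x y / x * y} -> bijective f -> isomorphic G H.
Proof.
move=> fM bijf; pose mM := isMultiplicative.Build G H f fM.
by pose F : {multiplicative G -> H} := HB.pack f mM; exists F.
Qed.

Lemma isomorphic_sym (G H : groupType) : isomorphic G H -> isomorphic H G.
Proof.
move=> [f [g fK gK]]; apply: (isomorphicI (can2_gmulfM fK gK)).
by exists f.
Qed.

Lemma isomorphic_trans (G H K : groupType) :
  isomorphic G H -> isomorphic H K -> isomorphic G K.
Proof.
move=> [f bijf] [g bijg]; apply: (@isomorphicI _ _ (g \o f)).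
  by move=> x y; rewrite /= !gmulfM.
exact: bij_comp.
Qed.

Lemma isomorphic_zmodI (U V : zmodType) (f : U -> V) :
  zmod_morphism f -> bijective f -> isomorphic_zmod U V.
Proof.
move=> fB bijf; pose mB := GRing.isZmodMorphism.Build U V f fB.
by pose F : {additive U -> V} := HB.pack f mB; exists F.
Qed.

Lemma isomorphic_zmod_sym (U V : zmodType) :
  isomorphic_zmod U V -> isomorphic_zmod V U.
Proof.
move=> [f [g fK gK]]; apply: (isomorphic_zmodI (can2_zmod_morphism fK gK)).
by exists f.
Qed.

Lemma isomorphic_zmod_trans (U V W : zmodType) :
  isomorphic_zmod U V -> isomorphic_zmod V W -> isomorphic_zmod U W.
Proof.
move=> [f bijf] [g bijg]; apply: (@isomorphic_zmodI _ _ (g \o f)).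
  by move=> x y; rewrite /= !raddfB.
exact: bij_comp.
Qed.

(** * Invariance of the curly wedge *)

Lemma presented_gen_ind (X : choiceType) (R : word X -> word X -> Prop)
    (Q : presented R -> Prop) :
  Q 1 -> (forall x a, Q a -> Q (presented_gen R x * a)) ->
  (forall x a, Q a -> Q ((presented_gen R x)^-1 * a)) -> forall a, Q a.
Proof.
move=> Q1 QM QV a; rewrite -[a]reprK; elim: (repr a) => [|[x b] w IHw] //.
have -> : \pi_(presented R) ((x, b) :: w) =
    (\pi [:: (x, b)] : presented R) * (\pi w : presented R).
  by rewrite -[RHS]/(presented_mul _ _) presented_mulE.
case: b; last exact: QM.
have -> : \pi_(presented R) [:: (x, true)] = (presented_gen R x)^-1.
  by rewrite -[RHS]/(presented_inv _) presented_invE.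
exact: QV.
Qed.

Section WedgeTheory.
Variable G : groupType.

Lemma wedge_hom_ext (H : groupType)
    (f g : {multiplicative curly_wedge G -> H}) :
  (forall x y, f (wedge x y) = g (wedge x y)) -> f =1 g.
Proof.
move=> fg; apply: presented_gen_ind => [|[x y] a IH|[x y] a IH].
- by rewrite !multiplicative1.
- by rewrite !gmulfM IH -/(wedge x y) fg.
- by rewrite !gmulfM !multiplicativeV IH -/(wedge x y) fg.
Qed.

Lemma wedge_lift (H : groupType) (f : G -> G -> H) :
  (forall m m' n, f (m * m') n = f (lconj m m') (lconj m n) * f m n) ->
  (forall m n n', f m (n * n') = f m n * f (lconj n m) (lconj n n')) ->
  (forall x y, x * y = y * x -> f x y = 1) ->
  exists F : {multiplicative curly_wedge G -> H},
    forall x y, F (wedge x y) = f x y.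
Proof.
move=> fMl fMr f1; pose ev := word_eval (fun p : G * G => f p.1 p.2).
have evR u v : wedge_rel u v -> ev u = ev v.
  case=> [m m' n|m n n'|x y /lcomm_eq1 xy];
    rewrite /ev /word_eval ?big_cons big_nil ?mulg1 /=; auto.
pose F0 : curly_wedge G -> H := presented_lift (fun p : G * G => f p.1 p.2).
have F0M : {morph F0 : a b / a * b} := presented_lift_mul evR.
pose mF := isMultiplicative.Build _ _ F0 F0M.
pose F : {multiplicative curly_wedge G -> H} := HB.pack F0 mF.
by exists F => x y; apply: (presented_lift_gen evR (x, y)).
Qed.

Lemma wedgeMl (m m' n : G) :
  wedge (m * m') n = wedge (lconj m m') (lconj m n) * wedge m n.
Proof.
rewrite -[RHS]/(presented_mul _ _) presented_mulE.
by apply/eqP/presented_eqP/word_eq_rel; constructor.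
Qed.

Lemma wedgeMr (m n n' : G) :
  wedge m (n * n') = wedge m n * wedge (lconj n m) (lconj n n').
Proof.
rewrite -[RHS]/(presented_mul _ _) presented_mulE.
by apply/eqP/presented_eqP/word_eq_rel; constructor.
Qed.

Lemma wedge_commute (x y : G) : x * y = y * x -> wedge x y = 1.
Proof.
move=> /lcomm_eq1 xy.
by apply/eqP/presented_eqP/word_eq_rel; constructor.
Qed.

(** Conjugation by a central element is trivial, and so is its wedge with any
element: the two defining expansions collapse. *)
Lemma wedge_centralM (z t m n : G) : z \in @center G -> t \in @center G ->
  wedge (z * m) (t * n) = wedge m n.
Proof.
move=> /centerP zZ /centerP tZ.
have lconjz x : lconj z x = x by rewrite /lconj zZ mulgK.
have lconjt x : lconj t x = x by rewrite /lconj tZ mulgK.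
rewrite wedgeMl !lconjz (wedge_commute (zZ _)) mulg1.
by rewrite wedgeMr !lconjt (wedge_commute (esym (tZ _))) mul1g.
Qed.

End WedgeTheory.

Section EpiInvariance.
Variables (P G : groupType) (pi : {multiplicative P -> G}).
Hypothesis pi_epi : isoclinic_epi pi.

Lemma wedge_fiber (p p' q q' : P) : pi p = pi p' -> pi q = pi q' ->
  wedge p q = wedge p' q'.
Proof.
have fib x y : pi x = pi y -> exists2 z, z \in @center P & x = z * y.
  move=> xy; exists (x * y^-1); last by rewrite mulgVK.
  apply/centerP => t; apply: (epi_ker_central pi_epi).
  by rewrite gmulfM multiplicativeV xy mulgV.
by move=> /fib[z zZ ->] /fib[t tZ ->]; apply: wedge_centralM.
Qed.

(** The inverse sends the wedge of [g] and [h] to the wedge of any of their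
lifts.  It respects the relations because lifts matter only up to the kernel,
and because lifts of a commuting pair commute. *)
Lemma epi_curly_wedge :
  exists F : {multiplicative curly_wedge P -> curly_wedge G},
    bijective F /\ forall w, val (kappa (F w)) = pi (val (kappa w)).
Proof.
have [s sK] := epi_section pi_epi.
have piL x y : pi (lconj x y) = lconj (pi x) (pi y).
  by rewrite /lconj !gmulfM multiplicativeV.
have [F FE] : exists F : {multiplicative curly_wedge P -> curly_wedge G},
    forall x y, F (wedge x y) = wedge (pi x) (pi y).
  apply: wedge_lift => [m m' n|m n n'|x y xy].
  - by rewrite gmulfM wedgeMl !piL.
  - by rewrite gmulfM wedgeMr !piL.
  - by apply: wedge_commute; rewrite -!gmulfM xy.
have [F' F'E] : exists F' : {multiplicative curly_wedge G -> curly_wedge P},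
    forall g h, F' (wedge g h) = wedge (s g) (s h).
  apply: wedge_lift => [m m' n|m n n'|x y xy].
  - rewrite (@wedge_fiber _ (s m * s m') _ (s n)) ?gmulfM ?sK // wedgeMl.
    by congr (_ * _); apply: wedge_fiber; rewrite piL !sK.
  - rewrite (@wedge_fiber _ (s m) _ (s n * s n')) ?gmulfM ?sK // wedgeMr.
    by congr (_ * _); apply: wedge_fiber; rewrite piL !sK.
  - by apply: wedge_commute; apply: (epi_commute pi_epi); rewrite !sK.
exists F; split.
  exists F' => w.
    apply: (wedge_hom_ext (f := F' \o F) (g := idfun)) => x y /=.
    by rewrite FE F'E; apply: wedge_fiber; rewrite sK.
  apply: (wedge_hom_ext (f := F \o F') (g := idfun)) => x y /=.
  by rewrite F'E FE !sK.
move=> w.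
apply: (wedge_hom_ext (f := val \o (@kappa G \o F))
                      (g := pi \o (val \o @kappa P))) => x y /=.
by rewrite FE !kappa_wedge /= (gmulf_lcomm pi).
Qed.

(** The map induced by [pi] on derived subgroups is injective, so
[kappa (F w)] is trivial exactly when [kappa w] is. *)
Lemma epi_B0_tilde : isomorphic (B0_tilde P) (B0_tilde G).
Proof.
have [F [bijF kF]] := epi_curly_wedge.
have kerF w : (F w \in @kappa_ker G) = (w \in @kappa_ker P).
  rewrite !inE; apply/eqP/eqP => [Fw1|w1]; apply: val_inj.
    by apply: pi_epi.2 (valP _) _; rewrite -kF Fw1.
  by rewrite kF w1 multiplicative1.
have FP (w : B0_tilde P) : F (sgval w) \in @kappa_ker G.
  by rewrite kerF sgvalP.
have sgval_inj K : injective (@sgval _ (@kappa_ker K)) by exact: val_inj.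
apply: (@isomorphicI _ _ (fun w => Subgroup (FP w) : B0_tilde G)).
  by move=> v w; apply: sgval_inj; apply: gmulfM.
apply: inj_surj_bijective.
  by move=> v w /(congr1 (@sgval _ _))/(bij_inj bijF)/sgval_inj.
have [F' FK F'K] := bijF => v.
have F'v : F' (sgval v) \in @kappa_ker P by rewrite -kerF F'K sgvalP.
by exists (Subgroup F'v); apply: sgval_inj; apply: F'K.
Qed.

Lemma epi_B0 : isomorphic_zmod (B0 P) (B0 G).
Proof.
apply: isomorphic_zmod_sym.
pose f (a : B0 G) : B0 P := MkB0 (inflation_bogomolov pi (B0valP a)).
have fB : zmod_morphism f.
  by move=> a b; apply: val_inj; apply: raddfB.
apply: (isomorphic_zmodI fB); apply: inj_surj_bijective.
  move=> a b /(congr1 val) /= fab; apply: val_inj; apply/eqP.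
  rewrite -GRing.subr_eq0; apply/eqP.
  apply: (inflation_inj pi_epi QmodZ_divisible).
  by rewrite raddfB; apply/eqP; rewrite GRing.subr_eq0; apply/eqP.
move=> b; have [a aB def_b] := bogomolov_inflation pi_epi (valP b).
by exists (MkB0 aB); apply: val_inj.
Qed.
End EpiInvariance.

(** * The fibre product of two isoclinic groups *)

Section FibreProduct.
Variables (G1 G2 : groupType).
Variables (alpha : {multiplicative central_quotient G1 -> central_quotient G2}).

Definition fibre_product_pred : {pred G1 * G2} :=
  [pred p | alpha (\pi p.1) == \pi p.2].

Lemma cq_piM (G : groupType) (x y : G) :
  \pi_(central_quotient G) (x * y) =
    (\pi x : central_quotient G) * (\pi y : central_quotient G).
Proof. by rewrite -[RHS]/(cq_mul _ _) cq_mulE. Qed.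

Lemma cq_piV (G : groupType) (x : G) :
  \pi_(central_quotient G) x^-1 = (\pi x : central_quotient G)^-1.
Proof. by rewrite -[RHS]/(cq_inv _) cq_invE. Qed.

Fact fibre_product_mul : mulg_closed fibre_product_pred.
Proof.
move=> p q; rewrite !inE => /eqP pP /eqP qP.
by rewrite !cq_piM gmulfM pP qP.
Qed.

Fact fibre_product_one : 1 \in fibre_product_pred.
Proof. by rewrite inE; apply/eqP; apply: (multiplicative1 alpha). Qed.

Fact fibre_product_inv : invg_closed fibre_product_pred.
Proof.
by move=> p; rewrite !inE => /eqP pP; rewrite !cq_piV multiplicativeV pP.
Qed.

HB.instance Definition _ :=
  isMulClosed.Build (G1 * G2)%type fibre_product_pred fibre_product_mul.
HB.instance Definition _ :=
  isMul1Closed.Build (G1 * G2)%type fibre_product_pred fibre_product_one.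
HB.instance Definition _ :=
  isInvClosed.Build (G1 * G2)%type fibre_product_pred fibre_product_inv.

Definition fibre_product : Type := subgroup fibre_product_pred.
HB.instance Definition _ := Group.on fibre_product.

Definition fibre_fst : {multiplicative fibre_product -> G1} :=
  fst \o (val : {multiplicative fibre_product -> (G1 * G2)%type}).
Definition fibre_snd : {multiplicative fibre_product -> G2} :=
  snd \o (val : {multiplicative fibre_product -> (G1 * G2)%type}).

Variable beta : {multiplicative derived_group G1 -> derived_group G2}.
Hypotheses (bij_alpha : bijective alpha) (bij_beta : bijective beta).
Hypothesis compat : forall (a1 b1 : G1) (a2 b2 : G2),
  alpha (\pi a1) = \pi a2 -> alpha (\pi b1) = \pi b2 ->
  beta (dcomm a1 b1) = dcomm a2 b2.

(** The derived subgroup of the fibre product lies in the graph of [beta]: by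
compatibility this holds for commutators, and the graph is a subgroup. *)
Lemma derived_fibre_product p : p \in @derived fibre_product ->
  exists d, fibre_fst p = val d /\ fibre_snd p = val (beta d).
Proof.
move=> /derivedP.
elim=> {p} [|x y|x y _ [d [xd xd']] _ [e [ye ye']]|x _ [d [xd xd']]].
- by exists 1; rewrite !multiplicative1.
- exists (dcomm (fibre_fst x) (fibre_fst y)).
  by rewrite (compat (eqP (valP x)) (eqP (valP y))) !gmulf_lcomm.
- by exists (d * e); rewrite !gmulfM xd ye xd' ye'.
- by exists d^-1; rewrite !multiplicativeV xd xd'.
Qed.

Lemma fibre_fst_epi : isoclinic_epi fibre_fst.
Proof.
split=> [g|p /derived_fibre_product[d [pd pd']] p1].
  have gP : (g, repr (alpha (\pi g))) \in fibre_product_pred.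
    by rewrite inE /= reprK.
  by exists (Subgroup gP).
have d1 : d = 1 by apply: val_inj; rewrite -pd p1.
apply: val_inj; rewrite [LHS]surjective_pairing; apply: (congr2 pair) => //.
by rewrite [LHS]pd' d1 !multiplicative1.
Qed.

Lemma fibre_snd_epi : isoclinic_epi fibre_snd.
Proof.
have [alpha' alphaK alpha'K] := bij_alpha.
split=> [g|p /derived_fibre_product[d [pd pd']] p1].
  have gP : (repr (alpha' (\pi g)), g) \in fibre_product_pred.
    by rewrite inE /= reprK alpha'K.
  by exists (Subgroup gP).
have d1 : d = 1.
  apply: (bij_inj bij_beta); apply: val_inj.
  by rewrite -pd' p1 !multiplicative1.
apply: val_inj; rewrite [LHS]surjective_pairing; apply: (congr2 pair) => //.
by rewrite [LHS]pd d1.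
Qed.
End FibreProduct.

Theorem theorem1p2 (G1 G2 : groupType) (isoG : isoclinic G1 G2) :
  isomorphic (B0_tilde G1) (B0_tilde G2) /\
  (finite_set [set: G1]%classic -> finite_set [set: G2]%classic ->
   isomorphic_zmod (B0 G1) (B0 G2)).
Proof.
have [alpha [beta [bij_alpha bij_beta compat]]] := isoG.
have epi1 := fibre_fst_epi compat.
have epi2 := fibre_snd_epi bij_alpha bij_beta compat.
split=> [|_ _].
  apply: isomorphic_trans (epi_B0_tilde epi2).
  exact: isomorphic_sym (epi_B0_tilde epi1).
exact: isomorphic_zmod_trans (isomorphic_zmod_sym (epi_B0 epi1)) (epi_B0 epi2).
Qed.
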